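(* Let $(X,f)$ be a dynamical system such that $f\colon X\to X$ is a surjection. If $(X,f)$ has the $\overline{d}$-shadowing property, then it is chain mixing.
   Context: $\mathbb{N}_0=\{0,1,2,\dots\}$. A dynamical system $(X,f)$ is a compact metric space $(X,d)$ together with a continuous map $f\colon X\to X$. For $A\subset\mathbb{N}_0$, $\overline{d}(A)=\limsup_{n\to\infty}\frac1n|A\cap\{0,\dots,n-1\}|$. A sequence $\{x_i\}_{i=0}^\infty\subset X$ is a $\delta$-ergodic pseudo-orbit of $f$ if $\lim_{n\to\infty}\frac1n|\{0\le i<n: d(f(x_i),x_{i+1})\ge\delta\}|=0$. $(X,f)$ has the $\overline{d}$-shadowing property if for every $\varepsilon>0$ there is $\delta>0$ such that for every $\delta$-ergodic pseudo-orbit $\{x_i\}_{i=0}^\infty$ of $f$ there is $z\in X$ with $\overline{d}(\{i\in\mathbb{N}_0: d(f^i(z),x_i)<\varepsilon\})>1/2$. A $\delta$-chain from $x$ to $y$ is a finite sequence $x_1,\dots,x_{n+1}$ in $X$ with $x_1=x$, $x_{n+1}=y$ and $d(f(x_i),x_{i+1})<\delta$ for $i=1,\dots,n$. $(X,f)$ is chain mixing if for any $x,y\in X$ and $\delta>0$ there is $N>0$ such that for every $n>N$ there is a $\delta$-chain from $x$ to $y$ consisting of exactly $n$ elements. *)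

(* Defs.v *)
From HB Require Import structures.
From mathcomp Require Import all_boot all_order all_algebra.
From mathcomp Require Import all_classical all_reals all_analysis.

Set Implicit Arguments.
Unset Strict Implicit.
Unset Printing Implicit Defensive.

Import Order.TTheory GRing.Theory Num.Theory.
Import numFieldNormedType.Exports.

Local Open Scope classical_set_scope.
Local Open Scope ring_scope.

(* The index n = 0 gives the junk value 0 / 0 = 0, irrelevant in the limit. *)
Definition frequency {R : realType} (A : set nat) (n : nat) : R :=
  #|[pred i : 'I_n | `[< A i >]]|%:R / n%:R.

(* [frequency A] takes values in [0, 1], so this real [limn_sup] is a genuine
   upper limit. *)
Definition upper_density {R : realType} (A : set nat) : R :=
  limn_sup (frequency A : nat -> R).

Definition ergodic_pseudo_orbit {R : realType} {X : metricType R}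
    (f : X -> X) (delta : R) (x : nat -> X) : Prop :=
  frequency [set i | delta <= mdist (f (x i)) (x i.+1)] @ \oo --> (0 : R).

Definition upper_density_shadowing {R : realType} {X : metricType R}
    (f : X -> X) : Prop :=
  forall eps : R, 0 < eps -> exists2 delta : R, 0 < delta &
    forall x : nat -> X, ergodic_pseudo_orbit f delta x ->
      exists z : X,
        1 / 2 < upper_density [set i | mdist (iter i f z) (x i) < eps] :> R.

(* A chain is given by the list of all its points, both endpoints included. *)
Definition delta_chain {R : realType} {X : metricType R}
    (f : X -> X) (delta : R) (x y : X) (s : seq X) : Prop :=
  exists p : seq X,
    [/\ s = x :: p, path (fun u v => mdist (f u) v < delta) x p
      & last x p = y].

Definition chain_mixing {R : realType} {X : metricType R}
    (f : X -> X) : Prop :=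
  forall (x y : X) (delta : R), 0 < delta ->
    exists2 N : nat, (0 < N)%N &
      forall n : nat, (N < n)%N ->
        exists2 s : seq X, delta_chain f delta x y s & size s = n.

(* Main.v *)
Require Import Defs.
From HB Require Import structures.
From mathcomp Require Import all_boot all_order all_algebra.
From mathcomp Require Import all_classical all_reals all_analysis.
From mathcomp Require Import zify lra.

Import Order.TTheory GRing.Theory Num.Theory.
Import numFieldNormedType.Exports.

Local Open Scope classical_set_scope.
Local Open Scope ring_scope.

(** The time axis is cut into the blocks [s^2, (s+1)^2), coloured by the parity
of s. Each colour occupies half of the time axis, with an error of order
sqrt n up to time n, while the ends of blocks have density zero. Hence, if p
and q are sequences that follow f inside each block, the sequence equal to p on
odd blocks and to q on even blocks is a delta-ergodic pseudo-orbit for every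
delta > 0. A point z that shadows it on a set of upper density above 1/2 must be
close to p at some time i and close to q at some later time j, because a set of
times that eventually meets one colour only has upper density at most 1/2.
Jumping from p i to the orbit of z, following that orbit, and jumping to q j
gives a chain from p i to q j with exactly j - i steps ([splice_chain]).

Two choices of p and q give the theorem.

- Let p be the orbit of x, and on each block let q be a backward orbit segment
  of y, which exists as f is onto, timed to reach y when the block ends. This
  gives a chain from x to y ([shadowing_chain_transitive]).

- Let p i be the i-th iterate of x and q i the (i+1)-st, a copy of the same
  orbit that runs one unit of time ahead. The resulting chain from the i-th to
  the (j+1)-st iterate has j - i steps, whereas the orbit of x joins the same
  points in j + 1 - i steps.

Closing both chains of the second choice with one return chain produces cycles
of consecutive lengths a and a + 1 at one point u. Concatenating them produces
cycles at u of every length from a^2 on ([chain_consecutive_cycles]), and a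
chain from x to y through u therefore exists in every large length. *)

(** * Counting times and blocks *)

Definition occurrences (A : set nat) (n : nat) : nat :=
  #|[pred i : 'I_n | `[< A i >]]|.

Lemma occurrences0 (A : set nat) : occurrences A 0 = 0%N.
Proof. by rewrite /occurrences eq_card0// => -[]. Qed.

Lemma occurrencesS (A : set nat) (n : nat) :
  occurrences A n.+1 = (occurrences A n + `[< A n >])%N.
Proof.
rewrite /occurrences -!sum1_card big_mkcond big_ord_recr/= -big_mkcond/=.
by congr addn; rewrite inE/=; case: `[< _ >].
Qed.

Lemma occurrences_le_tail (N : nat) (A B : set nat) (n : nat) :
  (forall i, (N <= i)%N -> A i -> B i) ->
  (occurrences A n <= N + occurrences B n)%N.
Proof.
move=> AB; have leN m : (occurrences A m <= m)%N.
  elim: m => [|m IH]; first by rewrite occurrences0.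
  by rewrite occurrencesS; case: asboolP => _; lia.
elim: n => [|n IH]; first by rewrite !occurrences0.
have [nN|Nn] := ltnP n N; first by have := leN n.+1; lia.
rewrite !occurrencesS; case: (asboolP (A n)) => [/(AB _ Nn) Bn|_]; last lia.
by rewrite asboolT//; lia.
Qed.

(** The integer part of the square root of n. *)
Fixpoint block (n : nat) : nat :=
  if n is m.+1 then
    if n == ((block m).+1 ^ 2)%N then (block m).+1 else block m
  else 0%N.

Lemma blockS (n : nat) :
  block n.+1 = if n.+1 == ((block n).+1 ^ 2)%N then (block n).+1 else block n.
Proof. by []. Qed.

Arguments block : simpl never.

Lemma block_bounds (n : nat) : (block n ^ 2 <= n < (block n).+1 ^ 2)%N.
Proof. by elim: n => // n IH; rewrite blockS; case: eqP => [->|]; nia. Qed.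

Definition block_parity (b : bool) : set nat := [set i | odd (block i) = b].

(** In the block of s, the numbers of times of the two colours up to n differ by
n - s^2 - s in favour of the colour of s: the alternating sum of the lengths
2k + 1 of the earlier blocks has absolute value s. *)
Lemma occurrences_block_parity (b : bool) (n : nat) :
  (if odd (block n) == b
   then 2 * occurrences (block_parity b) n + (block n ^ 2 + block n) = 2 * n
   else 2 * occurrences (block_parity b) n = block n ^ 2 + block n)%N.
Proof.
elim: n => [|n]; first by rewrite occurrences0; case: b.
rewrite occurrencesS blockS; set s := block n.
have -> : `[< block_parity b n >] = (odd s == b) by apply/asboolP/eqP.
case: (n.+1 =P (s.+1 ^ 2)%N) => [nS|_]; last by case: (_ == b); lia.
rewrite oddS; case: (odd s) b => -[] //=; nia.
Qed.

Lemma occurrences_block_parity_le (b : bool) (n : nat) :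
  (2 * occurrences (block_parity b) n <= n + block n)%N.
Proof.
have := occurrences_block_parity b n; have /andP[] := block_bounds n.
by case: (_ == b); nia.
Qed.

Lemma occurrences_block_end (n : nat) :
  occurrences [set i | block i.+1 <> block i] n = block n.
Proof.
elim: n => [|n IH]; first by rewrite occurrences0.
rewrite occurrencesS IH /= blockS; case: (eqP (x := n.+1)) => [_|_].
  by rewrite asboolT; lia.
by rewrite asboolF; lia.
Qed.

(** The form in which block n = o(n) is used: N accounts for a finite set of
initial times. *)
Lemma near_block_le (R : realType) (N : nat) (e : R) : 0 < e ->
  \forall n \near \oo, N%:R + (block n)%:R <= e * n%:R.
Proof.
move=> e0; near=> n.
have nB : (N%:R + (2 * e)^-1) * 2 / e <= n%:R.
  by near: n; exact: nbhs_infty_ger.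
have sn : (block n)%:R ^+ 2 <= n%:R :> R.
  by rewrite -natrX ler_nat; case/andP: (block_bounds n).
(* With s = block n, this is 2 (e s) <= (e s)^2 + 1 divided by 2 e. *)
have amgm : (block n)%:R <= e / 2 * (block n)%:R ^+ 2 + (2 * e)^-1.
  rewrite -(ler_pM2l (_ : 0 < 2 * e)) ?mulr_gt0// mulrDr divff; last by lra.
  have := sqr_ge0 (e * (block n)%:R - 1); nra.
by move: nB; rewrite ler_pdivrMr//; nra.
Unshelve. all: by end_near. Qed.

(** * Upper density *)

Lemma upper_density_le (R : realType) (A : set nat) (c : R) :
  (forall e : R, 0 < e ->
    \forall n \near \oo, (occurrences A n)%:R <= (c + e) * n%:R) ->
  upper_density A <= c.
Proof.
move=> Ac; have freq01 n : 0 <= (frequency A n : R) <= 1.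
  rewrite /frequency divr_ge0//=; case: n => [|n]; first by rewrite invr0 mulr0.
  by rewrite ler_pdivrMr// mul1r ler_nat -[leqRHS]card_ord max_card.
(* Boundedness makes the suprema of the tails converge, so that the limit which
   defines the upper density can be compared with a bound on those suprema. *)
have bounded : bounded_fun (frequency A : R^o^nat).
  exists 1; split; first exact: num_real.
  move=> M M1 n _ /=; have /andP[f0 f1] := freq01 n.
  by rewrite ger0_norm// (le_trans f1)// ltW.
have cvg_sups : cvgn (sups (frequency A : R^o^nat)).
  apply: nonincreasing_is_cvgn; last exact: bounded_fun_has_lbound_sups.
  exact/nonincreasing_sups/bounded_fun_has_ubound.
apply/ler_addgt0Pr => e e0; have [N _ AN] := Ac e e0.
apply: limr_le => //; near=> n.
apply: ge_sup; first by exists (frequency A n); exists n => /=.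
move=> _ [m /= nm <-].
have Nm : (N < m)%N by apply: leq_trans nm; near: n; exact: nbhs_infty_ge.
rewrite /frequency ler_pdivrMr ?ltr0n; last exact: leq_ltn_trans Nm.
exact: AN (ltnW Nm).
Unshelve. all: by end_near. Qed.

Lemma upper_density_tail_block_parity (R : realType) (b : bool) (N : nat)
    (A : set nat) :
  (forall i, (N <= i)%N -> A i -> block_parity b i) ->
  upper_density A <= 1 / 2 :> R.
Proof.
move=> Ab; apply: upper_density_le => e e0.
near=> n.
have : N%:R + (block n)%:R <= e * n%:R :> R by near: n; exact: near_block_le.
have := occurrences_le_tail _ _ _ n Ab; have := occurrences_block_parity_le b n.
rewrite -!(ler_nat R) !natrM !natrD => ? ? ?.
have : 0 <= (block n)%:R :> R by [].
lra.
Unshelve. all: by end_near. Qed.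

(** * Splicing two sequences *)

Definition splice {T : Type} (p q : nat -> T) (i : nat) : T :=
  if odd (block i) then p i else q i.

(** Errors occur only at the ends of blocks, and there are about sqrt n of them
up to time n. *)
Lemma splice_ergodic_pseudo_orbit {R : realType} {X : metricType R}
    (f : X -> X) (p q : nat -> X) (delta : R) :
  0 < delta ->
  (forall i, block i.+1 = block i -> f (p i) = p i.+1) ->
  (forall i, block i.+1 = block i -> f (q i) = q i.+1) ->
  ergodic_pseudo_orbit f delta (splice p q).
Proof.
move=> delta0 fp fq; apply/cvgrPdist_le => e e0; near=> n.
rewrite sub0r normrN /frequency -/(occurrences _ _) ger0_norm ?divr_ge0//.
have n0 : (0 < n)%N by near: n; exact: nbhs_infty_gt.
rewrite ler_pdivrMr ?ltr0n//.
have : 0%:R + (block n)%:R <= e * n%:R by near: n; exact: near_block_le.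
apply: le_trans; rewrite add0r ler_nat -occurrences_block_end.
apply: (occurrences_le_tail 0) => i _ /= jump same_block.
move: jump; rewrite /splice same_block.
by case: ifP => _;
  rewrite ?(fp _ same_block) ?(fq _ same_block) mdistxx leNgt delta0.
Unshelve. all: by end_near. Qed.

(** * Uniform continuity *)

Lemma compact_uniformly_continuous {R : realType} {X : metricType R}
    (f : X -> X) (delta : R) :
  compact [set: X] -> continuous f -> 0 < delta ->
  exists2 eps : R, 0 < eps &
    forall u v, mdist u v < eps -> mdist (f u) (f v) < delta.
Proof.
move=> cX cf delta0.
pose P (e : R) (u : X) := forall v, mdist u v < e -> mdist (f u) (f v) < delta.
have : \forall e \near 0^'+, [set: X] `<=` P e.
  move/compact_near_coveringP : cX; apply => u _.
  have d2 : 0 < delta / 2 by rewrite divr_gt0.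
  have [r /= r0 fr] : nbhs_ball_ (fun x d => [set y : X | mdist x y < d]) u
      [set v | mdist (f u) (f v) < delta / 2].
    apply/metricType_numDomainType.nbhs_mdistP.
    exact: metricType_numDomainType.cvgr_dist_lt (cf u) _ d2.
  have r2 : 0 < r / 2 by rewrite divr_gt0.
  exists ([set u' | mdist u u' < r / 2], [set e | e < r / 2]) => /=.
    split; last exact: nbhs_right_lt.
    by apply/metricType_numDomainType.nbhs_mdistP; exists (r / 2).
  move=> [u' e] /= [uu' er] v u'v.
  have fu' : mdist (f u) (f u') < delta / 2 by apply: fr => /=; lra.
  have fv : mdist (f u) (f v) < delta / 2.
    by apply: fr => /=; have := metric_triangle u u' v; lra.
  have := metric_triangle (f u') (f u) (f v).
  by rewrite (metric_sym (f u') (f u)); lra.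
move=> near_P.
have [eps /= [eps0 Peps]] := filter_ex (filterI (nbhs_right_gt 0) near_P).
by exists eps => // u v; exact: Peps.
Qed.

(** * Chains *)

(** Length counts steps, so a chain of length n has n + 1 points, and the one of
length 0 from x to x is allowed: this makes lengths additive. *)
Definition chain_of_length {R : realType} {X : metricType R}
    (f : X -> X) (delta : R) (n : nat) (x y : X) : Prop :=
  exists p : seq X,
    [/\ size p = n, path (fun u v => mdist (f u) v < delta) x p
      & last x p = y].

Lemma chain_cat {R : realType} {X : metricType R} {f : X -> X} {delta : R}
    {m n : nat} {x y z : X} :
  chain_of_length f delta m x y -> chain_of_length f delta n y z ->
  chain_of_length f delta (m + n) x z.
Proof.
move=> [p [<- xp <-]] [q [<- yq <-]]; exists (p ++ q).
by rewrite size_cat cat_path last_cat xp yq.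
Qed.

Lemma chain_step {R : realType} {X : metricType R} {f : X -> X} {delta : R}
    {x y : X} :
  mdist (f x) y < delta -> chain_of_length f delta 1 x y.
Proof. by move=> xy; exists [:: y]; rewrite /= xy. Qed.

Lemma chain_iter {R : realType} {X : metricType R} (f : X -> X) {delta : R}
    (n : nat) (x : X) :
  0 < delta -> chain_of_length f delta n x (iter n f x).
Proof.
move=> delta0; elim: n => [|n IH]; first by exists [::].
rewrite -addn1; apply: chain_cat IH _; apply: chain_step.
by rewrite addn1 mdistxx.
Qed.

Lemma chain_iter_cycle {R : realType} {X : metricType R} (f : X -> X)
    (delta : R) (k m : nat) (x : X) :
  chain_of_length f delta m x x -> chain_of_length f delta (k * m) x x.
Proof.
move=> cyc; elim: k => [|k IH]; first by exists [::].
by rewrite mulSn; apply: chain_cat IH.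
Qed.

(** Write n = k m + r with r < m. As r <= k, r of the k cycles of length m can
be replaced by cycles of length m + 1. *)
Lemma chain_consecutive_cycles {R : realType} {X : metricType R} (f : X -> X)
    (delta : R) (m n : nat) (x : X) :
  chain_of_length f delta m x x -> chain_of_length f delta m.+1 x x ->
  (0 < m)%N -> (m * m <= n)%N -> chain_of_length f delta n x x.
Proof.
move=> cm cSm m0 mn.
have rq : (n %% m <= n %/ m)%N.
  by apply: (@leq_trans m); [rewrite ltnW// ltn_mod|rewrite leq_divRL].
have -> : (n = (n %/ m - n %% m) * m + (n %% m) * m.+1)%N.
  by rewrite mulnBl mulnS [(n %% m + _)%N]addnC addnA subnK ?leq_mul// -divn_eq.
by apply: chain_cat; apply: chain_iter_cycle.
Qed.

(** * From shadowing to chain mixing *)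

(** The chain uses the shadowing point z: it goes from p i to the (i+1)-st
iterate of z, along the orbit of z up to time j - 1, and then to q j. Uniform
continuity controls the first jump, where f is applied to p i, and closeness at
time j controls the last one. *)
Lemma splice_chain {R : realType} {X : metricType R} (f : X -> X)
    (delta : R) (p q : nat -> X) :
  compact [set: X] -> continuous f -> upper_density_shadowing f ->
  0 < delta ->
  (forall i, block i.+1 = block i -> f (p i) = p i.+1) ->
  (forall i, block i.+1 = block i -> f (q i) = q i.+1) ->
  exists i j,
    (i < j)%N /\ chain_of_length f delta (j - i) (p i) (q j).
Proof.
move=> cX cf sh delta0 fp fq.
have [eta eta0 unif] := compact_uniformly_continuous f delta cX cf delta0.
have eps0 : 0 < Num.min eta delta by rewrite lt_min eta0.
have [delta' delta'0 trace] := sh _ eps0.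
have [z] := trace _ (splice_ergodic_pseudo_orbit f p q _ delta'0 fp fq).
set A := (X in upper_density X) => densA.
have meets b N : exists i, [/\ (N <= i)%N, A i & odd (block i) = b].
  apply: contrapT => no; move: densA; rewrite ltNge => /negP; apply.
  apply: (upper_density_tail_block_parity _ (~~ b) N) => i Ni Ai.
  have : odd (block i) <> b by move=> ib; apply: no; exists i.
  by rewrite /block_parity/=; case: (odd _); case: (b).
have [i [_ Ai iodd]] := meets true 0%N.
(* Both jumps take one step each, so j must be at least i + 2. *)
have [j [ij Aj jeven]] := meets false i.+2.
exists i, j; split; first exact: ltnW.
move: Ai Aj; rewrite /A /splice /= iodd jeven !lt_min.
move=> /andP[zp _] /andP[_ zq].
have enter : chain_of_length f delta 1 (p i) (iter i.+1 f z).
  by apply: chain_step; rewrite metric_sym; exact: (unif _ _ zp).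
have follow := chain_iter f (j - i.+2) (iter i.+1 f z) delta0.
have leave :
    chain_of_length f delta 1 (iter (j - i.+2) f (iter i.+1 f z)) (q j).
  apply: chain_step; rewrite -iterD -iterS.
  by have -> : ((j - i.+2 + i.+1).+1 = j)%N by lia.
have -> : (j - i = 1 + (j - i.+2) + 1)%N by lia.
exact: chain_cat (chain_cat enter follow) leave.
Qed.

(** Splice the orbit of x with backward orbits of y that are timed to reach y
when the block ends. The time j given by [splice_chain] lies somewhere inside a
block, and the true orbit of q j arrives at y at the end of that block. *)
Lemma shadowing_chain_transitive {R : realType} {X : metricType R}
    (f : X -> X) (delta : R) (x y : X) :
  compact [set: X] -> continuous f -> set_surj [set: X] [set: X] f ->
  upper_density_shadowing f -> 0 < delta ->
  exists n, chain_of_length f delta n x y.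
Proof.
move=> cX cf sf sh delta0.
have preim u : exists v, f v = u by have [v _ <-] := sf u I; exists v.
have [g fg] := choice preim.
pose q i := iter ((block i).+1 ^ 2 - i) g y.
have fq i : block i.+1 = block i -> f (q i) = q i.+1.
  move=> same_block; rewrite /q same_block.
  have /andP[_ lt_end] := block_bounds i.
  by rewrite -(subnSK lt_end) iterS fg.
have [i [j [_ pq]]] := splice_chain f delta (fun i => iter i f x) q
  cX cf sh delta0 (fun _ _ => erefl) fq.
exists (i + (j - i) + ((block j).+1 ^ 2 - j))%N.
apply: chain_cat (chain_cat (chain_iter f i x delta0) pq) _.
have fgK k : iter k f (iter k g y) = y.
  by elim: k => // k IH; rewrite iterSr iterS fg.
rewrite -[X in chain_of_length _ _ _ _ X](fgK ((block j).+1 ^ 2 - j)%N).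
exact: chain_iter.
Qed.

Theorem corollary3p8 (R : realType) (X : metricType R) (f : X -> X)
    (compact_X : compact [set: X]) (continuous_f : continuous f)
    (surjective_f : set_surj [set: X] [set: X] f)
    (shadowing_f : upper_density_shadowing f) :
  chain_mixing f.
Proof.
move=> x y delta delta0.
have [i [j [ij chain_m]]] :=
  splice_chain f delta (fun i => iter i f x) (fun i => iter i.+1 f x)
    compact_X continuous_f shadowing_f delta0
    (fun _ _ => erefl) (fun _ _ => erefl).
set u := iter i f x in chain_m; set m := (j - i)%N in chain_m.
have chain_Sm : chain_of_length f delta m.+1 u (iter j.+1 f x).
  have -> : (j.+1 = m.+1 + i)%N by rewrite /m; lia.
  by rewrite iterD; exact: chain_iter.
have trans a b := shadowing_chain_transitive f delta a b
  compact_X continuous_f surjective_f shadowing_f delta0.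
have [l chain_l] := trans (iter j.+1 f x) u.
have [l' chain_l'] := trans u y.
pose a := (m + l)%N.
have cyc_a : chain_of_length f delta a u u := chain_cat chain_m chain_l.
have cyc_Sa : chain_of_length f delta a.+1 u u := chain_cat chain_Sm chain_l.
(* A chain of n points has n - 1 steps: i steps lead to u, l' steps lead from u
   to y, and the others, at least a^2 of them, are spent in a cycle at u. *)
exists (i + a * a + l').+1 => // n n_large.
have : chain_of_length f delta (i + (n.-1 - i - l') + l') x y.
  apply: chain_cat chain_l'; apply: chain_cat (chain_iter f i x delta0) _.
  by apply: chain_consecutive_cycles cyc_a cyc_Sa _ _; rewrite /a /m; lia.
move=> [p [sz_p path_p last_p]]; exists (x :: p); first by exists p.
by rewrite /= sz_p; lia.
Qed.
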